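(* For $n\ge2$ let $e_n(y)=\sum_{\pi\in\mathcal{D}_{23\text{-}1}(n)}y^{\mu(\pi)}$ and let $E(x,y)=\sum_{n\ge2}e_n(y)\frac{x^n}{n!}$. For $j\ge3$ let $\gamma_j$ denote the finite continued fraction $$\gamma_j=2-j+\cfrac{j-2+(j-1)y}{3-j+\cfrac{j-3+(j-2)y}{\ddots\ -3+\cfrac{3+4y}{-2+\cfrac{2+3y}{-1}}}},$$ i.e. $\gamma_3=-1$ and $\gamma_j=2-j+\frac{j-2+(j-1)y}{\gamma_{j-1}}$ for $j\ge4$ (rational functions of $y$). Then $$E(x,y)=\sum_{k\ge2}\frac{y(e^x-1)^k}{k!}\prod_{j=3}^k\gamma_j,$$ and consequently, for $n\ge2$, $$e_n(y)=y\sum_{k=2}^n S(n,k)\prod_{j=3}^k\gamma_j,$$ where $S(n,k)$ denotes the Stirling number of the second kind (empty products equal $1$).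
   Context: Every permutation $\pi$ of $[n]=\{1,\dots,n\}$ is written in standard cycle form: each cycle is written starting with its smallest element, and the cycles are ordered from left to right by increasing first elements. The flattened form $\mathrm{flat}(\pi)$ is the word (in one-line notation) obtained by erasing the parentheses of the standard cycle form; e.g. $(135)(26)(478)$ has flattened form $13526478$. A derangement is a permutation with no fixed points; $\mathcal{D}(n)$ is the set of derangements of $[n]$, and $\mu(\pi)$ denotes the number of cycles of $\pi$. A word $w=w_1\cdots w_n$ of distinct integers contains the vincular pattern $23\text{-}1$ if there are indices $i$ and $k>i+1$ with $w_k<w_i<w_{i+1}$, and avoids it otherwise. $\mathcal{D}_{23\text{-}1}(n)$ is the set of $\pi\in\mathcal{D}(n)$ such that $\mathrm{flat}(\pi)$ avoids $23\text{-}1$. *)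

(* Defs.v *)
From HB Require Import structures.
From mathcomp Require Import all_boot all_order all_fingroup all_algebra.

Set Implicit Arguments.
Unset Strict Implicit.
Unset Printing Implicit Defensive.

Import Order.TTheory GRing.Theory Num.Theory.
Local Open Scope ring_scope.

(* The ground set [n] is represented by 'I_n, i.e. shifted to {0, ..., n-1};
   every notion below depends only on the relative order of the elements. *)

Section Permutations.
Variable n : nat.
Implicit Type s : 'S_n.

Definition cycle_minima s : seq 'I_n :=
  [seq x <- enum 'I_n | [forall y in porbit s x, (x <= y)%N]].

(* The list of the cycles (x, s x, s (s x), ...); enum 'I_n is increasing. *)
Definition standard_cycle_form s : seq (seq 'I_n) :=
  [seq traject s x #|porbit s x| | x <- cycle_minima s].

Definition flat s : seq nat := map val (flatten (standard_cycle_form s)).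

Definition derangement s : bool := [forall x, s x != x].

Definition mu s : nat := #|porbits s|.

End Permutations.

(* Indices are 0-based; i.+1 < k < size w keeps every access in range, so the
   default value of nth is never used. *)
Definition contains_23_1 (w : seq nat) : bool :=
  [exists i : 'I_(size w), exists k : 'I_(size w),
    (i.+1 < k)%N && (nth 0 w k < nth 0 w i < nth 0 w i.+1)%N].

Definition avoids_23_1 (w : seq nat) : bool := ~~ contains_23_1 w.

Definition D23_1 (n : nat) : {set 'S_n} :=
  [set s | derangement s & avoids_23_1 (flat s)].

Definition e (n : nat) : {poly rat} := \sum_(s in D23_1 n) 'X ^+ mu s.

(* The field Q(y) of rational functions in the indeterminate y. *)
Definition ratfun : fieldType := {fraction {poly rat}}.

Definition poly_ratfun (p : {poly rat}) : ratfun := tofrac p.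

Definition y : ratfun := poly_ratfun 'X.

(* Only the values at j >= 3 are meaningful; gamma 0 = gamma 1 = gamma 2 = -1
   are never used. *)
Fixpoint gamma (j : nat) : ratfun :=
  if j is i.+1 then
    if (j <= 3)%N then -1
    else 2 - j%:R + (j%:R - 2 + (j%:R - 1) * y) / gamma i
  else -1.

Lemma gamma3 : gamma 3 = -1.
Proof. by []. Qed.

Lemma gammaE (j : nat) : (4 <= j)%N ->
  gamma j = 2 - j%:R + (j%:R - 2 + (j%:R - 1) * y) / gamma j.-1.
Proof. by case: j => [|[|[|[|j]]]]. Qed.

(* Hence no division by 0 occurs in the continued fractions. *)
Lemma gamma_neq0 (j : nat) : gamma j != 0.
Proof.
suff [a [b [a0 b0 ->]]] : exists a b : {poly rat},
    [/\ 0 < a.[1], 0 < b.[1] & gamma j = - (tofrac a / tofrac b)].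
  rewrite oppr_eq0 mulf_eq0 invr_eq0 !tofrac_eq0 negb_or.
  by apply/andP; split; apply/eqP => c0; move: a0 b0; rewrite c0 horner0 ltxx.
have base : exists a b : {poly rat},
    [/\ 0 < a.[1], 0 < b.[1] & (-1 : ratfun) = - (tofrac a / tofrac b)].
  by exists 1, 1; rewrite hornerC ltr01 tofrac1 divr1; split.
elim: j => [|j [a [b [a0 b0 IH]]]]; first exact: base.
case: (leqP j.+1 3) => [le_j3|]; first by rewrite [gamma _]/= le_j3.
case: j IH => [|[|[|j]]] // IH _; rewrite gammaE // IH /=.
have nz (p : {poly rat}) : 0 < p.[1] -> tofrac p != 0.
  by move=> p0; rewrite tofrac_eq0; apply/eqP => p00; rewrite p00 horner0 ltxx in p0.
have -> : (2 - j.+4%:R : ratfun) = - j.+2%:R.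
  by rewrite -[j.+4]/(2 + j.+2)%N natrD opprD addrA subrr add0r.
have -> : (j.+4%:R - 2 : ratfun) = j.+2%:R.
  by rewrite -[j.+4]/(2 + j.+2)%N natrD addrC addrA addNr add0r.
have -> : (j.+4%:R - 1 : ratfun) = j.+3%:R.
  by rewrite -[j.+4]/(1 + j.+3)%N natrD addrC addrA addNr add0r.
have: (0 < j.+3)%N by []. have: (0 < j.+2)%N by [].
move: j.+2 j.+3 => k l k0 l0.
exists (k%:R * a + (k%:R + l%:R * 'X) * b), a; split=> //.
  have nat1 i : (i%:R : {poly rat}).[1] = i%:R by rewrite -polyC_natr hornerC.
  rewrite !(hornerD, hornerM, hornerX, nat1) mulr1.
  by rewrite addr_gt0 ?mulr_gt0 ?addr_gt0 ?ltr0n.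
rewrite !rmorphD !rmorphM rmorphD rmorphM !rmorph_nat.
by rewrite invrN invf_div mulrN [in RHS]mulrDl mulfK ?nz // opprD mulrA.
Qed.

(* Stirling number of the second kind: the number of partitions of an
   n-element set into k (nonempty) blocks. *)
Definition stirling2 (n k : nat) : nat :=
  #|[set P : {set {set 'I_n}} | partition P [set: 'I_n] & #|P| == k]|.

(* Formal power series in x, given by their coefficient sequences. *)
Section FormalPowerSeries.
Variable K : fieldType.

Definition fps := nat -> K.

Implicit Types f g : fps.

Definition fps_one : fps := fun n => (n == 0%N)%:R.

Definition fps_sub f g : fps := fun n => f n - g n.

Definition fps_mul f g : fps := fun n => \sum_(i < n.+1) f i * g (n - i)%N.

Definition fps_scale (c : K) f : fps := fun n => c * f n.

Definition fps_pow f (k : nat) : fps := iter k (fps_mul f) fps_one.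

Definition fps_exp : fps := fun n => (n`!%:R)^-1.

(* sum_(k >= m) F k = f in the usual (coefficientwise) sense: each coefficient
   of the partial sums is eventually constant, equal to that of f. *)
Definition fps_has_sum (m : nat) (F : nat -> fps) f : Prop :=
  forall n, exists N, forall M, (N <= M)%N -> \sum_(m <= k < M) F k n = f n.

End FormalPowerSeries.

Definition E : fps ratfun :=
  fun n => if (2 <= n)%N then poly_ratfun (e n) / n`!%:R else 0.

Definition expm1 : fps ratfun := fps_sub (fps_exp ratfun) (fps_one ratfun).

(* Main.v *)
Require Import Defs.
From mathcomp Require Import all_boot all_order all_fingroup all_algebra.
From mathcomp Require Import zify ring.

(* The letters of flat(pi) are 1 A 2 B. Avoiding 23-1 means exactly that A is
   decreasing and 2 B avoids 23-1, so A is an arbitrary subset of the remaining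
   letters. In the standard cycle form of a derangement the letter 2 opens a new
   cycle (A nonempty, and the rest is a form on 2 B), or lies inside the cycle of
   1 without closing it (opening a cycle at 2 instead again gives a form on 2 B),
   or closes that cycle (the rest is a form on B). Hence, with e_0 = 1, e_1 = 0,
     e_(n+2) = (1 + y) sum_j C(n,j) e_(j+1) - y e_(n+1) + y sum_j C(n,j) e_j,
   i.e. E'' = (1 + y) e^x E' - y E' + y e^x E for E = 1 + sum_(n >= 2).
   Substituting t = e^x - 1 turns this into (1 + t) G'' = (1 + y) t G' + y G,
   whose coefficients satisfy
     q_(m+2) = - m q_(m+1) + (m + (m+1) y) q_m,  q_0 = 1, q_1 = 0;
   dividing by q_(m+1) gives the recurrence of the continued fractions, so that
   q_k = y gamma_3 ... gamma_k. *)

Set Implicit Arguments.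
Unset Strict Implicit.
Unset Printing Implicit Defensive.

Import GRing.Theory Num.Theory.
Local Open Scope ring_scope.

(** * Stirling and binomial transforms *)

(** The triangular recurrence of the Stirling numbers of the second kind; [stirling2E] identifies it
    with the count of set partitions. *)
Fixpoint stir (n k : nat) : nat :=
  match n, k with
  | 0, 0 => 1
  | n'.+1, k'.+1 => k * stir n' k + stir n' k'
  | _, _ => 0
  end%N.

Lemma stirS (n k : nat) :
  stir n.+1 k.+1 = (k.+1 * stir n k.+1 + stir n k)%N.
Proof. by []. Qed.

Lemma stir_gt (n k : nat) : (n < k)%N -> stir n k = 0%N.
Proof. by elim: n k => [|n IH] [|k] //= ltnk; rewrite !IH; lia. Qed.

Definition stir_step (R : pzRingType) (q : nat -> R) (k : nat) : R :=
  k%:R * q k + q k.+1.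

(* If q lists the coefficients of the exponential series G(t), then
   stirling_transform q n is the n-th coefficient of G(e^x - 1); stir_step is
   the differentiation d/dx = (1 + t) d/dt. *)
Fixpoint stirling_transform (R : pzRingType) (q : nat -> R) (n : nat) : R :=
  if n is m.+1 then stirling_transform (stir_step q) m else q 0%N.

(** Pascal's form of sum_j C(n,j) f(j), the coefficients of e^x F for the exponential series F of f.
    The recursion matches that of [splits]. *)
Fixpoint binomial_transform (R : pzRingType) (f : nat -> R) (n : nat) : R :=
  if n is m.+1 then
    binomial_transform f m + binomial_transform (fun j => f j.+1) m
  else f 0%N.

Lemma eq_stirling_transform (R : pzRingType) (q q' : nat -> R) (n : nat) :
  q =1 q' -> stirling_transform q n = stirling_transform q' n.
Proof.
elim: n q q' => [|n IH] q q' eqq /=; first exact: eqq.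
by apply: IH => k; rewrite /stir_step !eqq.
Qed.

Lemma stirling_transformD (R : comPzRingType) (a b : R) (q q' : nat -> R)
    (n : nat) :
  stirling_transform (fun k => a * q k + b * q' k) n =
    a * stirling_transform q n + b * stirling_transform q' n.
Proof.
elim: n q q' => [//|n IH] q q' /=; rewrite -IH.
by apply: eq_stirling_transform => k; rewrite /stir_step; ring.
Qed.

Lemma binomial_transformD (R : comPzRingType) (a b : R) (f g : nat -> R)
    (n : nat) :
  binomial_transform (fun j => a * f j + b * g j) n =
    a * binomial_transform f n + b * binomial_transform g n.
Proof. by elim: n f g => [//|n IH] f g /=; rewrite !IH; ring. Qed.

Lemma stirling_transformE (R : pzRingType) (q : nat -> R) (n : nat) :
  stirling_transform q n = \sum_(k < n.+1) (stir n k)%:R * q k.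
Proof.
elim: n q => [|n IH] q; first by rewrite big_ord1 mul1r.
rewrite [LHS]/= IH [RHS]big_ord_recl mul0r add0r.
under eq_bigr => k _ do rewrite mulrDr.
under [RHS]eq_bigr => k _ do rewrite lift0 stirS natrD mulrDl natrM.
rewrite !big_split /=; congr (_ + _).
(* The weight k kills the term k = 0 on the left, and S(n, n+1) = 0 kills the top term on the
   right. *)
rewrite big_ord_recl mul0r mulr0 add0r [RHS]big_ord_recr /=.
rewrite stir_gt // mulr0 mul0r addr0.
by apply: eq_bigr => k _; rewrite mulrA -!natrM mulnC.
Qed.

(* Multiplication of G(e^x - 1) by e^x = 1 + t. *)
Lemma binomial_stirling_transform (R : comPzRingType) (q : nat -> R) (n : nat) :
  binomial_transform (stirling_transform q) n =
    stirling_transform (fun k => q k + k%:R * q k.-1) n.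
Proof.
elim: n q => [|n IH] q /=; first by rewrite mul0r addr0.
rewrite (IH q) (IH (stir_step q)).
rewrite -[X in X + _]mul1r -[X in _ + X]mul1r -stirling_transformD.
apply: eq_stirling_transform => k; rewrite /stir_step.
by case: k => [|k] /=; rewrite -?natr1; ring.
Qed.

(* In terms of G this says: (1 + t) G'' = (1 + v) t G' + v G implies
   E'' = (1 + v) e^x E' - v E' + v e^x E for E(x) = G(e^x - 1). *)
Lemma stirling_transform_rec (R : comPzRingType) (v : R) (q : nat -> R) :
  (forall m, q m.+2 = - (m%:R * q m.+1) + (m%:R + m.+1%:R * v) * q m) ->
  forall n, stirling_transform q n.+2 =
    (1 + v) * binomial_transform (fun j => stirling_transform q j.+1) n
    + v * binomial_transform (stirling_transform q) n
    - v * stirling_transform q n.+1.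
Proof.
move=> qrec n; rewrite /= (binomial_stirling_transform (stir_step q)).
rewrite binomial_stirling_transform -stirling_transformD.
rewrite -[X in X - _]mul1r -mulNr -stirling_transformD.
apply: eq_stirling_transform => -[|k]; rewrite /stir_step /= !qrec.
  by rewrite -?natr1; ring.
by rewrite -?natr1; ring.
Qed.

(** * Counting set partitions *)

Definition partitions_of (T : finType) (A : {set T}) (k : nat) :
    {set {set {set T}}} :=
  [set P | partition P A & #|P| == k].

Lemma card_partitions_set0 (T : finType) (k : nat) :
  #|partitions_of (set0 : {set T}) k| = (k == 0)%N.
Proof.
case: k => [|k] /=.
  rewrite -(cards1 (set0 : {set {set T}})); congr #|pred_of_set _|.
  apply/setP => P; rewrite !inE partition_set0 cards_eq0.
  by case: eqP => // ->; rewrite eqxx.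
apply: eq_card0 => P; rewrite !inE partition_set0.
by apply/negP => /andP[/eqP->]; rewrite cards0.
Qed.

(* Inserting a new element x into the block B of P; B = set0 stands for the
   creation of a new block. *)
Definition insert_in_block (T : finType) (x : T) (PB : {set {set T}} * {set T}) :=
  (x |: PB.2) |: (PB.1 :\ PB.2).

Lemma partition_insert (T : finType) (x : T) (A : {set T}) P B :
  x \notin A -> partition P A -> B \in set0 |: P ->
  [/\ partition (insert_in_block x (P, B)) (x |: A),
      #|insert_in_block x (P, B)| = #|P| + (B == set0)
    & x |: B \notin P :\ B]%N.
Proof.
move=> xA Ppart BP; have P0 : set0 \notin P by case/and3P: Ppart.
have sBA : B \subset A.
  by move: BP; rewrite !inE => /predU1P[->|]; rewrite ?sub0set //;
     apply: partitionS.
have xBP : x |: B \notin P.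
  apply: contra xA => /(partitionS Ppart)/subsetP; apply.
  by rewrite !inE eqxx.
have partD : partition (P :\ B) (A :\: B).
  move: BP; rewrite !inE => /predU1P[->|BP]; last exact: partitionD1.
  have/setDidPl -> : [disjoint P & [set set0]] by rewrite disjoint_sym disjoints1.
  by rewrite setD0.
have xBPB : x |: B \notin P :\ B by rewrite !inE negb_and xBP orbT.
split=> //.
  have -> : x |: A = (x |: B) :|: (A :\: B).
    by rewrite -setUA setDE setUIr setUCr setIT (setUidPr sBA).
  apply: partitionU1 => //; first by apply/set0Pn; exists x; rewrite !inE eqxx.
  rewrite -setI_eq0; apply/eqP/setP => z; rewrite !inE.
  by case: eqP => [->|_] /=; rewrite ?(negPf xA) ?andbF //; case: (z \in B).
rewrite /insert_in_block cardsU1 xBPB [#|P|](cardsD1 B).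
move: BP; rewrite !inE; case: eqP => [->|_ /= ->]; last by rewrite addn0.
by rewrite (negPf P0) addnC.
Qed.

(** Makes insertion injective. The final removal of [set0] handles the case where x forms a block of
    its own. *)
Lemma insert_in_blockK (T : finType) (x : T) (A : {set T}) P B :
  x \notin A -> partition P A -> B \in set0 |: P ->
  let Q := insert_in_block x (P, B) in
  B = pblock Q x :\ x /\ P = (B |: (Q :\ pblock Q x)) :\ set0.
Proof.
move=> xA Ppart BP Q; have [Qpart _ xBP] := partition_insert xA Ppart BP.
have P0 := partition0 Ppart.
have xB : x \notin B.
  move: BP; rewrite !inE => /predU1P[->|BP]; first by rewrite inE.
  by apply: contra xA; apply/subsetP/(partitionS Ppart).
have -> : pblock Q x = x |: B.
  apply: def_pblock; first exact: partition_trivIset Qpart.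
    by rewrite !inE eqxx.
  by rewrite !inE eqxx.
split; first by rewrite setU1K.
rewrite /Q /insert_in_block setU1K //=.
apply/setP => C; rewrite !inE.
move: BP; rewrite !inE; case: (eqVneq C set0) => [->|C0] //=.
by move=> BP; move: C0; case: (eqVneq C B) BP => [->|//] /=; case: eqVneq.
Qed.

Lemma partition_insertP (T : finType) (x : T) (A : {set T}) Q :
  x \notin A -> partition Q (x |: A) ->
  exists P B, [/\ partition P A, B \in set0 |: P
                & Q = insert_in_block x (P, B)].
Proof.
move=> xA Qpart; have Q0 := partition0 Qpart.
have xQ : x \in cover Q by rewrite (cover_partition Qpart) !inE eqxx.
pose C := pblock Q x; have CQ : C \in Q by apply: pblock_mem.
have xC : x \in C by rewrite mem_pblock.
have sCA := partitionS Qpart CQ; have partD := partitionD1 Qpart CQ.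
(* Take x out of its block C. If x was alone, the remainder [set0] is discarded from the partition
   and B = [set0] records the new block. *)
exists ((C :\ x |: (Q :\ C)) :\ set0), (C :\ x).
have QE : Q = C |: (Q :\ C) by rewrite setD1K.
have disC B : B \in Q :\ C -> [disjoint C & B].
  rewrite !inE => /andP[BC BQ].
  have/trivIsetP := partition_trivIset Qpart; apply => //.
  by rewrite eq_sym.
have CxQ : (C :\ x \in Q :\ C) = false.
  apply/negP => CxQ; have := disC _ CxQ; rewrite -setI_eq0 => /eqP CCx.
  have : C :\ x == set0.
    by rewrite -subset0 -CCx subsetI subsetDl subxx.
  by move/eqP => Cx0; move: CxQ; rewrite Cx0 !inE Q0 andbF.
have Q0' : Q :\ C :\ set0 = Q :\ C.
  by apply/setP => B; rewrite !inE; case: eqVneq => // ->; rewrite Q0 andbF.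
have AE : A = (C :\ x) :|: ((x |: A) :\: C).
  apply/setP => z; rewrite !inE; have := subsetP sCA z; rewrite !inE.
  case: (eqVneq z x) => [->|zx] /=; first by rewrite xC (negPf xA).
  by case: (z \in C) => //= ->.
have insE : insert_in_block x ((C :\ x |: (Q :\ C)) :\ set0, C :\ x) = Q.
  rewrite /insert_in_block /= setD1K // [RHS]QE; congr (_ |: _).
  apply/setP => B; rewrite !inE; case: (eqVneq B (C :\ x)) => [->|_] /=.
    by move: CxQ; rewrite !inE => ->.
  by case: eqVneq => //= ->; rewrite Q0 andbF.
split=> //; last first.
  by rewrite !inE; case: (eqVneq (C :\ x) set0) => //= _; rewrite eqxx.
have [Cx0|Cx0] := eqVneq (C :\ x) set0.
  have -> : (C :\ x |: (Q :\ C)) :\ set0 = Q :\ C.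
    by rewrite Cx0 setDUl setDv set0U.
  by have -> : A = (x |: A) :\: C by rewrite {1}AE Cx0 set0U.
have -> : (C :\ x |: (Q :\ C)) :\ set0 = C :\ x |: (Q :\ C).
  rewrite setDUl Q0'; congr (_ :|: _); apply/setP => B; rewrite !inE.
  by case: (eqVneq B (C :\ x)) => [->|]; rewrite ?Cx0 ?andbF.
rewrite [in partition _ A]AE; apply: partitionU1 => //.
rewrite -setI_eq0; apply/eqP/setP => z; rewrite !inE.
by case: (z \in C); rewrite ?andbF.
Qed.

(** Insertion is a bijection from the pairs (P, B) onto the partitions of x |: A. A partition P with
    k blocks gives one result, from B = [set0]; one with k+1 blocks gives k+1, from its own
    blocks. *)
Lemma card_partitions_setU1 (T : finType) (x : T) (A : {set T}) (k : nat) :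
  x \notin A ->
  #|partitions_of (x |: A) k.+1| =
    (k.+1 * #|partitions_of A k.+1| + #|partitions_of A k|)%N.
Proof.
move=> xA.
pose S := [set PB : {set {set T}} * {set T} |
  [&& partition PB.1 A, PB.2 \in set0 |: PB.1
    & (#|PB.1| + (PB.2 == set0) == k.+1)%N]].
have -> : partitions_of (x |: A) k.+1 = insert_in_block x @: S.
  apply/setP => Q; apply/idP/imsetP.
    rewrite inE => /andP[Qpart /eqP cQ].
    have [P [B [Ppart BP QE]]] := partition_insertP xA Qpart.
    exists (P, B) => //; rewrite inE Ppart BP /=.
    by have [_ <- _] := partition_insert xA Ppart BP; rewrite -QE cQ.
  move=> [[P B]]; rewrite inE /= => /and3P[Ppart BP /eqP cP] ->.
  by have [Qpart cQ _] := partition_insert xA Ppart BP; rewrite inE Qpart cQ cP /=.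
rewrite card_in_imset; last first.
  move=> [P B] [P' B'] /[1!inE] /and3P[/= Ppart BP _].
  move=> /[1!inE] /and3P[/= P'part B'P' _].
  have [BE PE] := insert_in_blockK xA Ppart BP.
  have [B'E P'E] := insert_in_blockK xA P'part B'P'.
  move=> eqQ; have eqB : B = B' by rewrite BE B'E eqQ.
  by congr (_, _) => //; rewrite PE P'E eqQ eqB.
rewrite -sum1_card.
transitivity (\sum_(P | partition P A) \sum_(B in set0 |: P)
                 (#|P| + (B == set0) == k.+1))%N.
  rewrite pair_big_dep /= big_mkcond [RHS]big_mkcond /=.
  apply: eq_bigr => -[P B] _; rewrite !inE /=.
  by case: (partition P A); case: (_ || _) => //=; case: eqP.
transitivity (\sum_(P | partition P A) ((#|P| == k) + k.+1 * (#|P| == k.+1)))%N.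
  apply: eq_bigr => P Ppart; have P0 := partition0 Ppart.
  rewrite big_setU1 ?P0 //= eqxx addn1 eqSS; congr (_ + _)%N.
  rewrite (eq_bigr (fun=> nat_of_bool (#|P| == k.+1))) => [|B BP].
    by rewrite sum_nat_const; case: eqP => [->|] //; rewrite !muln0.
  by rewrite (negPf (partition_neq0 Ppart BP)) addn0.
rewrite big_split /= -big_distrr /= addnC; congr (_ * _ + _)%N.
  rewrite -sum1_card big_mkcond [RHS]big_mkcond /=.
  by apply: eq_bigr => P _; rewrite inE; case: (partition P A) => //=; case: eqP.
rewrite -sum1_card big_mkcond [RHS]big_mkcond /=.
by apply: eq_bigr => P _; rewrite inE; case: (partition P A) => //=; case: eqP.
Qed.

Lemma card_partitions (T : finType) (A : {set T}) (k : nat) :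
  #|partitions_of A k| = stir #|A| k.
Proof.
move cA: #|A| => n; elim: n A k cA => [|n IH] A k.
  by move/eqP; rewrite cards_eq0 => /eqP->; rewrite card_partitions_set0; case: k.
move=> cA; have /card_gt0P[x xA] : (0 < #|A|)%N by rewrite cA.
have cAx : #|A :\ x| = n by move: cA; rewrite (cardsD1 x) xA => -[].
rewrite -(setD1K xA); case: k => [|k].
  apply: eq_card0 => P; rewrite !inE; apply/negP => /andP[Ppart].
  rewrite cards_eq0 => /eqP P0; have := cover_partition Ppart.
  rewrite P0 /cover big_set0 => /setP/(_ x).
  by rewrite !inE eqxx.
by rewrite card_partitions_setU1 ?inE ?eqxx // !IH.
Qed.

Lemma stirling2E (n k : nat) : stirling2 n k = stir n k.
Proof. by rewrite -[n in RHS]card_ord -cardsT -card_partitions. Qed.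

(** * Powers of e^x - 1 *)

Definition fps_deriv (K : fieldType) (f : fps K) : fps K :=
  fun n => n.+1%:R * f n.+1.

Lemma fps_derivM (K : fieldType) (f g : fps K) (n : nat) :
  fps_deriv (fps_mul f g) n =
    fps_mul (fps_deriv f) g n + fps_mul f (fps_deriv g) n.
Proof.
rewrite /fps_deriv /fps_mul mulr_sumr.
transitivity (\sum_(i < n.+2) i%:R * f i * g (n.+1 - i)%N +
              \sum_(i < n.+2) f i * ((n.+1 - i)%:R * g (n.+1 - i)%N)).
  rewrite -big_split /=; apply: eq_bigr => i _.
  have -> : n.+1%:R = i%:R + (n.+1 - i)%:R :> K.
    by rewrite -natrD subnKC // -ltnS.
  by ring.
congr (_ + _).
  by rewrite big_ord_recl !mul0r add0r.
rewrite big_ord_recr /= subnn mul0r mulr0 addr0.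
by apply: eq_bigr => i _; rewrite subSn // -ltnS.
Qed.

Lemma fps_mulDr (K : fieldType) (f g h : fps K) (n : nat) :
  fps_mul f (fun i => g i + h i) n = fps_mul f g n + fps_mul f h n.
Proof. by rewrite /fps_mul -big_split; apply: eq_bigr => i _; rewrite mulrDr. Qed.

Lemma fps_mulZr (K : fieldType) (c : K) (f g : fps K) (n : nat) :
  fps_mul f (fun i => c * g i) n = c * fps_mul f g n.
Proof. by rewrite /fps_mul mulr_sumr; apply: eq_bigr => i _; rewrite mulrCA. Qed.

Lemma eq_fps_mul (K : fieldType) (f f' g g' : fps K) (n : nat) :
  f =1 f' -> g =1 g' -> fps_mul f g n = fps_mul f' g' n.
Proof. by move=> ff' gg'; apply: eq_bigr => i _; rewrite ff' gg'. Qed.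

Lemma fps_mul1l (K : fieldType) (f : fps K) (n : nat) :
  fps_mul (fps_one K) f n = f n.
Proof.
rewrite /fps_mul big_ord_recl mul1r subn0 big1 ?addr0 // => i _.
by rewrite mul0r.
Qed.

Lemma fps_mulDl (K : fieldType) (f g h : fps K) (n : nat) :
  fps_mul (fun i => f i + g i) h n = fps_mul f h n + fps_mul g h n.
Proof. by rewrite /fps_mul -big_split; apply: eq_bigr => i _; rewrite mulrDl. Qed.

Definition fps_expm1 (K : fieldType) : fps K :=
  fps_sub (fps_exp K) (fps_one K).

Lemma pchar0_natf_neq0 (K : fieldType) (n : nat) :
  [pchar K] =i pred0 -> n.+1%:R != 0 :> K.
Proof. by move/pcharf0P => ->. Qed.

Lemma deriv_expm1 (K : fieldType) (n : nat) : [pchar K] =i pred0 ->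
  fps_deriv (fps_expm1 K) n = fps_expm1 K n + fps_one K n.
Proof.
move=> K0; rewrite /fps_deriv /fps_expm1 /fps_sub /fps_exp subrK subr0.
by rewrite factS natrM invfM mulrA divff ?mul1r // pchar0_natf_neq0.
Qed.

(** For u = e^x - 1 one has u' = u + 1, hence (u^k)' = k u^(k-1) u' = k (u^k + u^(k-1)). *)
Lemma deriv_expm1_pow (K : fieldType) (k n : nat) : [pchar K] =i pred0 ->
  fps_deriv (fps_pow (fps_expm1 K) k) n =
    k%:R * (fps_pow (fps_expm1 K) k n + fps_pow (fps_expm1 K) k.-1 n).
Proof.
move=> K0; elim: k n => [|k IH] n; first by rewrite /fps_deriv mulr0 mul0r.
have D1 i := @deriv_expm1 K i K0.
rewrite [fps_pow _ _]/= fps_derivM (eq_fps_mul _ D1 (frefl _)).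
rewrite fps_mulDl fps_mul1l (eq_fps_mul _ (frefl _) IH) fps_mulZr fps_mulDr.
case: k {IH} => [|k]; first by rewrite mul0r addr0 mul1r.
rewrite -[fps_mul _ (fps_pow _ k) n]/(fps_pow (fps_expm1 K) k.+1 n).
rewrite -[k.+2.-1]/k.+1 -[k.+2%:R]natr1.
by move: (fps_mul _ _ _) (fps_pow _ _ _) => a b; ring.
Qed.

(** Comparing coefficients in the formula for (u^k)' gives the recurrence of [stir]; characteristic
    0 allows the factor n+1 to be cancelled. *)
Lemma expm1_pow_coef (K : fieldType) (k n : nat) : [pchar K] =i pred0 ->
  fps_pow (fps_expm1 K) k n = k`!%:R * (stir n k)%:R / n`!%:R.
Proof.
move=> K0; elim: n k => [|n IH] k.
  case: k => [|k]; first by rewrite /= fact0 divr1 mulr1.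
  rewrite /= /fps_mul big_ord1 /fps_expm1 /fps_sub /fps_exp invr1 subrr.
  by rewrite mul0r mulr0 mul0r.
have n0 := pchar0_natf_neq0 n K0.
apply: (mulfI n0); have := deriv_expm1_pow k n K0; rewrite /fps_deriv => ->.
case: k => [|k]; first by rewrite mul0r mulr0 mul0r mulr0.
rewrite !IH stirS !factS !natrM natrD natrM invfM [k.+1.-1]/=.
have : (n`!%:R : K) != 0 by rewrite (pcharf0P K).1 // -lt0n fact_gt0.
move: n0; move: (n.+1%:R : K) (n`!%:R : K) => a b a0 b0.
by field; rewrite a0 b0.
Qed.

Lemma pchar_ratfun : [pchar ratfun] =i pred0.
Proof.
apply/pcharf0P => n; rewrite -(rmorph_nat (@tofrac {poly rat})) tofrac_eq0.
by rewrite -polyC_natr polyC_eq0 pnatr_eq0.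
Qed.

(** * Standard cycle forms of avoiding derangements *)

Lemma avoids_23_1_nil : avoids_23_1 [::].
Proof. by apply/negP => /existsP[[]]. Qed.

(** An occurrence either starts at x, so that the next letter is the larger one, or lies inside w.
    For empty w the default 0 of [head] makes the ascent fail. *)
Lemma avoids_23_1_cons (x : nat) (w : seq nat) :
  avoids_23_1 (x :: w) =
    ~~ ((x < head 0 w)%N && has (gtn x) (behead w)) && avoids_23_1 w.
Proof.
rewrite /avoids_23_1 -negb_or; congr (~~ _); apply/idP/orP.
  case/existsP=> -[i lti] /existsP[[k ltk]] /= /andP[ik /andP[ki ii]].
  case: i lti ik ki ii => [|i] lti ik ki ii; [left | right].
    case: w k ltk ik ki ii {lti} => [|z u] [|[|k]] //= ltk _ ki ii.
    rewrite ii; apply/hasP; exists (nth 0%N u k); last exact: ki.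
    exact: mem_nth.
  case: k ltk ik ki => // k ltk ik ki.
  apply/existsP; exists (Ordinal (lti : (i < size w)%N)).
  by apply/existsP; exists (Ordinal (ltk : (k < size w)%N)); rewrite /= ki ii; lia.
case=> [/andP[xz /hasP[t tu /= tx]]|].
  case: w xz tu => [|z u] //= xz tu.
  have tsz : (index t u < size u)%N by rewrite index_mem.
  apply/existsP; exists ord0; apply/existsP.
  exists (inord (index t u).+2); rewrite /= inordK /= ?nth_index ?xz ?tx //; lia.
case/existsP=> -[i lti] /existsP[[k ltk]] /= /andP[ik /andP[ki ii]].
apply/existsP; exists (inord i.+1); apply/existsP; exists (inord k.+1).
by rewrite /= !inordK /= ?ki ?ii ?andbT //; lia.
Qed.

(* An ascent inside R would form a 23-1 with the letter b, and the descending
   run from R down to b starts no occurrence. *)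
Lemma avoids_23_1_split (a b : nat) (R B : seq nat) :
  (a < b)%N -> all (ltn b) R -> all (ltn b) B -> uniq R ->
  avoids_23_1 (a :: R ++ b :: B) = sorted gtn R && avoids_23_1 (b :: B).
Proof.
move=> ab bR bB uR; rewrite avoids_23_1_cons.
have -> : has (gtn a) (behead (R ++ b :: B)) = false.
  apply/hasP => -[z /mem_behead]; rewrite mem_cat inE /= => zw za.
  by case/or3P: zw => [/(allP bR)|/eqP|/(allP bB)] /=; lia.
rewrite andbF /=; elim: R bR uR => [//|x R IH] /= /andP[bx bR] /andP[xR uR].
rewrite avoids_23_1_cons IH //; case: R {IH} bR xR uR => [|z R] /=.
  by rewrite ltnNge ltnW.
move=> /andP[bz bR]; rewrite inE negb_or => /andP[xz _] _; rewrite andbA.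
congr (_ && _ && _).
have -> : has (gtn x) (R ++ b :: B) by rewrite has_cat /= bx orbT.
by rewrite andbT -leqNgt leq_eqVlt eq_sym (negPf xz).
Qed.

(** * Splitting a list into two complementary subsequences *)

Fixpoint splits (T : Type) (L : seq T) : seq (seq T * seq T) :=
  if L is x :: L' then
    [seq (x :: p.1, p.2) | p <- splits L'] ++
    [seq (p.1, x :: p.2) | p <- splits L']
  else [:: ([::], [::])].

Lemma size_splits (T : eqType) (L : seq T) p :
  p \in splits L -> (size p.2 <= size L)%N.
Proof.
elim: L p => [|x L IH] p /=; first by rewrite inE => /eqP->.
by rewrite mem_cat => /orP[] /mapP[q /IH qL ->] /=; rewrite ?ltnS // leqW.
Qed.

Lemma sum_splits (R : pzRingType) (T : Type) (f : nat -> R) (L : seq T) :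
  \sum_(p <- splits L) f (size p.2) = binomial_transform f (size L).
Proof.
elim: L f => [|x L IH] f /=; first by rewrite big_seq1.
by rewrite big_cat !big_map /= IH (IH (fun j => f j.+1)).
Qed.

(** Only the split that sends all of L to the second component has an empty first one. *)
Lemma sum_splits_nil (R : pzRingType) (T : Type) (f : nat -> R) (L : seq T) :
  \sum_(p <- splits L | nilp p.1) f (size p.2) = f (size L).
Proof.
elim: L f => [|x L IH] f /=; first by rewrite big_mkcond big_seq1.
by rewrite big_cat !big_map /= big_pred0_eq add0r (IH (fun j => f j.+1)).
Qed.

Definition ord_lt (N : nat) : rel 'I_N := fun x z => (x < z)%N.

Lemma ord_lt_trans (N : nat) : transitive (@ord_lt N).
Proof. by move=> z x t; apply: ltn_trans. Qed.

Lemma ord_lt_irr (N : nat) : irreflexive (@ord_lt N).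
Proof. by move=> x; apply: ltnn. Qed.

Lemma sorted_ord_lt_cons (N : nat) (x : 'I_N) L :
  sorted (@ord_lt N) (x :: L) = all (ord_lt x) L && sorted (@ord_lt N) L.
Proof. exact/path_sortedE/ord_lt_trans. Qed.

Lemma sorted_ord_lt_uniq (N : nat) (L : seq 'I_N) :
  sorted (@ord_lt N) L -> uniq L.
Proof. apply: sorted_uniq; [exact: ord_lt_trans | exact: ord_lt_irr]. Qed.

Lemma sorted_min_head (N : nat) (x : 'I_N) A :
  sorted (@ord_lt N) A -> x \in A -> {in A, forall z : 'I_N, x <= z}%N ->
  exists A', A = x :: A'.
Proof.
case: A => [//|a A']; rewrite sorted_ord_lt_cons => /andP[aA _].
rewrite inE => /predU1P[->|/(allP aA) ax] /(_ a (mem_head _ _)).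
  by exists A'.
by rewrite leqNgt (ax : a < x)%N.
Qed.

(** The least letter x of L must head the sorted component that contains it; removing it there
    leaves a split of the tail. *)
Lemma mem_splits (N : nat) (L A K : seq 'I_N) :
  sorted (@ord_lt N) L ->
  ((A, K) \in splits L) =
    [&& sorted (@ord_lt N) A, sorted (@ord_lt N) K & perm_eq (A ++ K) L].
Proof.
elim: L A K => [|x L IH] A K.
  move=> _; rewrite inE; apply/eqP/and3P => [[-> ->] //|[_ _ /perm_nilP]].
  by case: A; case: K.
rewrite sorted_ord_lt_cons => /andP[xL sL]; apply/idP/and3P.
  rewrite mem_cat => /orP[] /mapP[[A' K'] /[dup] AK'].
    rewrite IH // => /and3P[sA sK pAK] [-> ->].
    rewrite sorted_ord_lt_cons sA sK /= perm_cons pAK; split=> //.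
    by move: xL; rewrite -(perm_all _ pAK) all_cat => /andP[->].
  rewrite IH // => /and3P[sA sK pAK] [-> ->].
  rewrite sorted_ord_lt_cons sA sK /= -cat1s perm_catCA /= perm_cons pAK.
  by split=> //; move: xL; rewrite -(perm_all _ pAK) all_cat => /andP[_ ->].
move=> [sA sK pAK]; have xmin z : z \in A ++ K -> (x <= z)%N.
  by rewrite (perm_mem pAK) inE => /predU1P[->//|/(allP xL)/ltnW].
have: x \in A ++ K by rewrite (perm_mem pAK) mem_head.
rewrite !mem_cat => /orP[xA|xK].
  have [|A' AE] := sorted_min_head sA xA.
    by move=> z zA; apply: xmin; rewrite mem_cat zA.
  apply/orP; left; apply/mapP; exists (A', K); last by rewrite AE.
  move: sA pAK; rewrite AE sorted_ord_lt_cons /= perm_cons => /andP[_ sA] pAK.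
  by rewrite IH // sA sK.
have [|K' KE] := sorted_min_head sK xK.
  by move=> z zK; apply: xmin; rewrite mem_cat zK orbT.
apply/orP; right; apply/mapP; exists (A, K'); last by rewrite KE.
move: sK pAK; rewrite KE sorted_ord_lt_cons -cat1s perm_catCA /= perm_cons.
by move=> /andP[_ sK] pAK; rewrite IH // sA sK.
Qed.

Lemma uniq_splits (N : nat) (L : seq 'I_N) :
  sorted (@ord_lt N) L -> uniq (splits L).
Proof.
elim: L => [//|x L IH] /[dup] sxL; rewrite sorted_ord_lt_cons => /andP[xL sL].
have xNL : x \notin L by have := sorted_ord_lt_uniq sxL => /= /andP[].
rewrite /= cat_uniq !map_inj_uniq ?IH //=; last 2 first.
- by move=> [A K] [A' K'] [-> ->].
- by move=> [A K] [A' K'] [-> ->].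
rewrite andbT; apply/hasPn => _ /mapP[[A K] AK ->]; apply/mapP => -[[A' K'] _ /=].
case=> AE _; move: AK; rewrite mem_splits // AE => /and3P[_ _ /perm_mem/(_ x)].
by rewrite (negPf xNL) inE eqxx.
Qed.

(** * Recursive enumeration of the forms and its generating function *)

(** Serves the case where b lies inside the first cycle without closing it: the cycle opened by b is
    absorbed into the one that begins with r. *)
Definition glue (T : Type) (r : seq T) (c : seq (seq T)) : seq (seq T) :=
  if c is r' :: c' then (r ++ r') :: c' else [::].

Lemma size_glue (T : Type) (r : seq T) c : size (glue r c) = size c.
Proof. by case: c. Qed.

(* The first cycle starts with the letters a, rev A; then b opens a new cycle,
   or lies inside the first cycle without closing it, or closes it. *)
Definition forms_step (T : Type) (F : seq T -> seq (seq (seq T))) (a b : T)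
    (p : seq T * seq T) : seq (seq (seq T)) :=
  (if nilp p.1 then [::] else [seq (a :: rev p.1) :: c | c <- F (b :: p.2)]) ++
  [seq glue (a :: rev p.1) c | c <- F (b :: p.2)] ++
  [seq (a :: rcons (rev p.1) b) :: c | c <- F p.2].

(* The number m is fuel: it only has to exceed size L. *)
Fixpoint forms (T : Type) (m : nat) (L : seq T) : seq (seq (seq T)) :=
  if m is m'.+1 then
    match L with
    | [::] => [:: [::]]
    | [:: _] => [::]
    | a :: b :: L' => flatten [seq forms_step (forms m') a b p | p <- splits L']
    end
  else [::].

Lemma sum_forms (R : comPzRingType) (v : R) (q : nat -> R) (T : eqType) :
  q 0%N = 1 -> q 1%N = 0 ->
  (forall m, q m.+2 = - (m%:R * q m.+1) + (m%:R + m.+1%:R * v) * q m) ->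
  forall m (L : seq T), (size L < m)%N ->
  \sum_(c <- forms m L) v ^+ size c = stirling_transform q (size L).
Proof.
move=> q0 q1 qrec; elim=> [//|m IH] [|a [|b L]] /= szL.
- by rewrite big_seq1 q0.
- by rewrite big_nil /stir_step mul0r add0r q1.
rewrite ltnS in szL; rewrite big_flatten big_map.
(* Gluing keeps the number of cycles, while the two other families add one cycle. The first family
   is absent when A is empty, whence the subtracted term. *)
have stepE p : p \in splits L ->
    \sum_(c <- forms_step (forms m) a b p) v ^+ size c =
      (1 + v) * stirling_transform q (size p.2).+1
      + v * stirling_transform q (size p.2)
      - (if nilp p.1 then v * stirling_transform q (size p.2).+1 else 0).
  move=> /size_splits szp; rewrite /forms_step !big_cat /= !big_map.
  under [X in _ + (X + _)]eq_bigr do rewrite size_glue.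
  under [X in _ + (_ + X)]eq_bigr do rewrite /= exprS.
  have szm : ((size p.2).+1 < m)%N by apply: leq_ltn_trans szL.
  rewrite -mulr_sumr (IH (b :: p.2)) // (IH p.2) ?(ltnW szm) //=.
  case: nilp; first by rewrite big_nil; ring.
  rewrite big_map; under eq_bigr do rewrite /= exprS.
  by rewrite -mulr_sumr (IH (b :: p.2)) //=; ring.
rewrite (eq_big_seq _ stepE) sumrB -big_mkcond /=.
rewrite (sum_splits_nil (fun j => v * stirling_transform q j.+1)).
rewrite (sum_splits (fun j => (1 + v) * stirling_transform q j.+1
                              + v * stirling_transform q j)).
by rewrite binomial_transformD -(stirling_transform_rec qrec).
Qed.

(** * Soundness and completeness of the enumeration *)

(** Both conditions of the standard cycle form in one: each cycle is nonempty, and its head is below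
    every later letter of its own cycle and of the following ones. *)
Fixpoint heads_min (N : nat) (c : seq (seq 'I_N)) : bool :=
  if c is r :: c' then
    (if r is x :: r' then all (ord_lt x) (r' ++ flatten c') else false)
    && heads_min c'
  else true.

Definition flat_form (N : nat) (c : seq (seq 'I_N)) : seq nat :=
  map val (flatten c).

(** The standard cycle forms of avoiding derangements, over an arbitrary list L of letters so that
    the recursion can pass to sublists. *)
Definition valid_form (N : nat) (L : seq 'I_N) (c : seq (seq 'I_N)) : bool :=
  [&& perm_eq (flatten c) L, all (fun r => 1 < size r)%N c, heads_min c
    & avoids_23_1 (flat_form c)].

Lemma valid_form_head (N : nat) (a : 'I_N) L c :
  sorted (@ord_lt N) (a :: L) -> perm_eq (flatten c) (a :: L) -> heads_min c ->
  exists r c', c = (a :: r) :: c'.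
Proof.
case: c => [|[|x r] c] //=; first by move=> _ /perm_size.
rewrite (path_sortedE (@ord_lt_trans N)) => /andP[aL _] pc /andP[xrc _].
exists r, c; congr ((_ :: _) :: _); apply/eqP.
have : x \in a :: L by rewrite -(perm_mem pc) mem_head.
rewrite inE => /predU1P[->//|/(allP aL) ax].
have : a \in x :: r ++ flatten c by rewrite (perm_mem pc) mem_head.
rewrite inE => /predU1P[->//|/(allP xrc)]; rewrite /ord_lt in ax * => xa.
by have := ltn_trans ax xa; rewrite ltnn.
Qed.

(** Avoidance forces the letters between a and b to decrease, so they are [rev A] for a sorted A.
    Being an equality, it serves both soundness and completeness. *)
Lemma word_split (N : nat) (a b : 'I_N) (L A K B : seq 'I_N) :
  sorted (@ord_lt N) [:: a, b & L] -> sorted (@ord_lt N) K -> perm_eq B K ->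
  ((A, K) \in splits L) && avoids_23_1 (map val (b :: B)) =
    perm_eq (a :: rev A ++ b :: B) [:: a, b & L] &&
    avoids_23_1 (map val (a :: rev A ++ b :: B)).
Proof.
rewrite sorted_ord_lt_cons => /andP[/= /andP[ab aL]] /[dup] sbL.
rewrite (path_sortedE (@ord_lt_trans N)) => /andP[bL sL] sK pBK.
rewrite mem_splits // sK /=.
have -> : perm_eq (a :: rev A ++ b :: B) [:: a, b & L] = perm_eq (A ++ K) L.
  rewrite perm_cons -[b :: B]cat1s perm_catCA /= perm_cons.
  apply: (@permPl _ (rev A ++ B) (A ++ K) _ L).
  by apply: perm_cat => //; rewrite perm_rev.
case: (boolP (perm_eq (A ++ K) L)) => [pAK|]; last by rewrite !andbF.
have bAK : all (ord_lt b) (A ++ K) by rewrite (perm_all _ pAK).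
have uAK : uniq (A ++ K) by rewrite (perm_uniq pAK) sorted_ord_lt_uniq.
rewrite andbT /= map_cat /= avoids_23_1_split; last 4 first.
- exact: ab.
- by rewrite all_map all_rev; move: bAK; rewrite all_cat => /andP[].
- by rewrite all_map (perm_all _ pBK); move: bAK; rewrite all_cat => /andP[].
- rewrite (map_inj_uniq val_inj) rev_uniq.
  by move: uAK; rewrite cat_uniq => /andP[].
by rewrite map_rev rev_sorted sorted_map.
Qed.

Lemma valid_form_cons (N : nat) (b : 'I_N) K c :
  sorted (@ord_lt N) (b :: K) -> valid_form (b :: K) c ->
  exists r c', [/\ c = (b :: r) :: c', r != [::] & perm_eq (r ++ flatten c') K].
Proof.
move=> sbK /and4P[pc szc hc _].
have [r [c' cE]] := valid_form_head sbK pc hc; exists r, c'.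
move: pc szc; rewrite cE /= perm_cons => pc /andP[szr _].
by split=> //; case: r szr {cE pc}.
Qed.

(** Soundness of one step. The shape of the word is recorded too, because [uniq_forms] recovers the
    split (A, K) from it. *)
Lemma mem_forms_step (N : nat) (F : seq 'I_N -> seq (seq (seq 'I_N)))
    (a b : 'I_N) (L A K : seq 'I_N) c :
  sorted (@ord_lt N) [:: a, b & L] -> (A, K) \in splits L ->
  F K =i valid_form K -> F (b :: K) =i valid_form (b :: K) ->
  c \in forms_step F a b (A, K) ->
  valid_form [:: a, b & L] c /\
  exists2 B, flatten c = a :: rev A ++ b :: B & perm_eq B K.
Proof.
move=> sL AK FK FbK.
have [sA sK pAK] : [/\ sorted (@ord_lt N) A, sorted (@ord_lt N) K
                     & perm_eq (A ++ K) L].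
  apply/and3P; rewrite -mem_splits //.
  by move: sL; rewrite !sorted_ord_lt_cons => /and3P[].
have [aL bL] : all (ord_lt a) (b :: L) /\ all (ord_lt b) L.
  by move: sL; rewrite !sorted_ord_lt_cons => /and3P[-> ->].
have bK : all (ord_lt b) K.
  by move: bL; rewrite -(perm_all _ pAK) all_cat => /andP[].
have sbK : sorted (@ord_lt N) (b :: K) by rewrite sorted_ord_lt_cons bK.
have wordP B : perm_eq B K -> avoids_23_1 (map val (b :: B)) ->
    [/\ perm_eq (a :: rev A ++ b :: B) [:: a, b & L],
        avoids_23_1 (map val (a :: rev A ++ b :: B))
      & all (ord_lt a) (rev A ++ b :: B)].
  move=> pB avB; have := word_split A sL sK pB; rewrite AK avB /=.
  case/esym/andP=> pw avw; split=> //.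
  by move: pw; rewrite perm_cons => /perm_all->.
rewrite /forms_step !mem_cat => /or3P[].
- case: ifP => //= A0 /mapP[c1]; rewrite FbK => vc1 ->.
  have [r [c' [cE r0 pB]]] := valid_form_cons sbK vc1.
  case/and4P: vc1; rewrite /flat_form cE => _ sz1 h1 av1.
  have [pw avw aw] := wordP _ pB av1.
  split; last by exists (r ++ flatten c').
  rewrite /valid_form /flat_form /= pw avw aw andbT size_rev.
  by move: h1 sz1 => /= -> ->; rewrite ltnS lt0n; move: A0; rewrite /nilp => ->.
- case/mapP=> c1; rewrite FbK => vc1 ->.
  have [r [c' [cE r0 pB]]] := valid_form_cons sbK vc1.
  case/and4P: vc1; rewrite /flat_form cE => _ /= /andP[_ sz1] /andP[_ h1] av1.
  have [pw avw aw] := wordP _ pB av1.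
  split; last by exists (r ++ flatten c'); rewrite //= -catA.
  rewrite /valid_form /flat_form /= -catA /= pw avw aw h1 sz1 !andbT.
  by rewrite size_cat /= addnS.
- case/mapP=> c1; rewrite FK => /and4P[pB sz1 h1 av1] ->.
  (* The letter b is below all letters of [c1], so it starts no occurrence of 23-1. *)
  have avb : avoids_23_1 (map val (b :: flatten c1)).
    rewrite /= avoids_23_1_cons [avoids_23_1 _]av1 andbT negb_and; apply/orP; right.
    apply/hasPn => _ /mem_behead/mapP[z zc ->]; rewrite /= -leqNgt ltnW //.
    by apply: (allP bK); rewrite -(perm_mem pB).
  have [pw avw aw] := wordP _ pB avb.
  split; last by exists (flatten c1); rewrite //= cat_rcons.
  rewrite /valid_form /flat_form /= cat_rcons pw avw aw h1 sz1 !andbT.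
  by rewrite size_rcons.
Qed.

(** Completeness of one step: b is the second smallest letter, so it lies in the cycle of a or heads
    the second cycle. *)
Lemma forms_step_complete (N : nat) (F : seq 'I_N -> seq (seq (seq 'I_N)))
    (a b : 'I_N) (L : seq 'I_N) c :
  sorted (@ord_lt N) [:: a, b & L] ->
  (forall A K, (A, K) \in splits L ->
     F K =i valid_form K /\ F (b :: K) =i valid_form (b :: K)) ->
  valid_form [:: a, b & L] c ->
  exists2 p, p \in splits L & c \in forms_step F a b p.
Proof.
move=> sL FP vc; have [r [c' [cE r0 pr]]] := valid_form_cons sL vc.
case/and4P: vc; rewrite /flat_form cE /= => pc /andP[_ szc'] /andP[_ hc'] avc.
have [aL sbL bL] : [/\ all (ord_lt a) (b :: L), sorted (@ord_lt N) (b :: L)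
                     & all (ord_lt b) L].
  by move: sL; rewrite !sorted_ord_lt_cons => /and3P[-> -> ->].
have sLL : sorted (@ord_lt N) L by move: sbL; rewrite sorted_ord_lt_cons => /andP[].
(* Wherever b stands, the split is read off the word: R reversed is A, and K lists the letters of B
   in the order of L. *)
have wordP R B : r ++ flatten c' = R ++ b :: B ->
    exists K, [/\ (rev R, K) \in splits L, perm_eq B K
                & avoids_23_1 (map val (b :: B))].
  move=> rE; have pRB : perm_eq (R ++ B) L.
    move: pr; rewrite rE -[b :: B]cat1s perm_catCA /=.
    by rewrite perm_cons.
  have uB : uniq B.
    have: uniq (R ++ B) by rewrite (perm_uniq pRB) sorted_ord_lt_uniq.
    by rewrite cat_uniq => /and3P[].
  pose K := [seq x <- L | x \in B]; exists K.
  have pBK : perm_eq B K.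
    apply: uniq_perm => //; first by rewrite filter_uniq ?sorted_ord_lt_uniq.
    move=> x; rewrite mem_filter -(perm_mem pRB) mem_cat.
    by case: (x \in B); rewrite ?orbT.
  have sK : sorted (@ord_lt N) K by apply: sorted_filter sLL; apply: ord_lt_trans.
  have := word_split (rev R) sL sK pBK; rewrite revK.
  by rewrite -rE pc avc => /andP[RK avB].
have sbK A K : (A, K) \in splits L -> sorted (@ord_lt N) (b :: K).
  rewrite mem_splits // => /and3P[_ sK pAK]; rewrite sorted_ord_lt_cons sK andbT.
  by move: bL; rewrite -(perm_all _ pAK) all_cat => /andP[].
have bK A K : (A, K) \in splits L -> all (ord_lt b) K.
  by move/sbK; rewrite sorted_ord_lt_cons => /andP[].
(* If b is in the first cycle, [r0] is what follows it there, and it is empty exactly when b closes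
   the cycle. *)
have [br|br] := boolP (b \in r).
  case/splitPr: br cE r0 pr wordP pc avc => R r0 cE _ pr wordP pc avc.
  have [|K [RK pB avB]] := wordP R (r0 ++ flatten c'); first by rewrite -catA.
  exists (rev R, K) => //; have [FK FbK] := FP _ _ RK.
  rewrite /forms_step !mem_cat revK; apply/orP; right; apply/orP.
  have [r0E|r0N] := eqVneq r0 [::]; [right|left]; apply/mapP.
    exists c'; last by rewrite r0E /= -cats1.
    rewrite FK; move: pB avB; rewrite r0E /= => pB avB.
    rewrite [_ \in _]/(valid_form _ _) /valid_form pB szc' hc' /=.
    by move: avB; rewrite avoids_23_1_cons => /andP[].
  exists ((b :: r0) :: c') => //.
  rewrite FbK [_ \in _]/(valid_form _ _) /valid_form /flat_form /= perm_cons pB.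
  rewrite avB szc' hc' (perm_all _ pB) (bK _ _ RK) !andbT.
  by case: r0 r0N {cE pr wordP pc avc pB avB}.
have bc' : b \in flatten c'.
  have: b \in r ++ flatten c' by rewrite (perm_mem pr) mem_head.
  by rewrite mem_cat (negPf br).
(* No letter of c' is smaller than b, so b is the head of the second cycle. *)
have [r1 [c1 c'E]] : exists r1 c1, c' = (b :: r1) :: c1.
  case: c' hc' bc' pr {cE pc szc' avc wordP} => [|[|x r1] c1] //= /andP[xr1 _] bc' pr.
  exists r1, c1; congr ((_ :: _) :: _); apply/eqP.
  move: bc'; rewrite inE => /predU1P[->//|/(allP xr1) xb].
  have: x \in b :: L by rewrite -(perm_mem pr) mem_cat mem_head orbT.
  rewrite inE => /predU1P[->//|/(allP bL) bx].
  by have := ord_lt_trans bx xb; rewrite ord_lt_irr.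
have [|K [RK pB avB]] := wordP r (r1 ++ flatten c1); first by rewrite c'E.
exists (rev r, K) => //; have [FK FbK] := FP _ _ RK.
rewrite /forms_step !mem_cat revK; apply/orP; left => /=.
rewrite /nilp size_rev size_eq0 (negPf r0); apply/mapP; exists c' => //.
rewrite FbK [_ \in _]/(valid_form _ _) /valid_form szc' hc' /flat_form c'E /=.
by rewrite perm_cons pB.
Qed.

Lemma mem_forms (N m : nat) (L : seq 'I_N) :
  (size L < m)%N -> sorted (@ord_lt N) L -> forms m L =i valid_form L.
Proof.
elim: m L => [//|m IH] [|a [|b L]] szL sL c.
- rewrite inE; apply/eqP/idP => [->|/and4P[/perm_nilP c0 szc _ _]].
    by rewrite [_ \in _]/(valid_form _ _) /valid_form avoids_23_1_nil.
  by case: c c0 szc => [|[]].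
- rewrite in_nil; apply/esym/negP => /(valid_form_cons sL)[r [c' [_ r0]]].
  by move/perm_size; rewrite size_cat; case: r r0.
have FP A K : (A, K) \in splits L ->
    forms m K =i valid_form K /\ forms m (b :: K) =i valid_form (b :: K).
  move=> AK; have szK := size_splits AK.
  have [sbL bL sLL] : [/\ sorted (@ord_lt N) (b :: L), all (ord_lt b) L
                       & sorted (@ord_lt N) L].
    by move: sL; rewrite !sorted_ord_lt_cons => /and3P[_ -> ->].
  have szm : ((size K).+1 < m)%N by rewrite -ltnS; apply: leq_ltn_trans szL.
  move: AK; rewrite mem_splits // => /and3P[_ sK pAK].
  split; apply: IH => //; first exact: ltnW.
  rewrite sorted_ord_lt_cons sK andbT.
  by move: bL; rewrite -(perm_all _ pAK) all_cat => /andP[].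
apply/flatten_mapP/idP => [[[A K] AK cs]|vc].
  by have [FK FbK] := FP _ _ AK; have [] := mem_forms_step sL AK FK FbK cs.
by have [p pL cp] := forms_step_complete sL FP vc; exists p.
Qed.

(** * The enumeration has no repetitions *)

Lemma uniq_flatten_map (S T : eqType) (g : S -> seq T) (s : seq S) :
  uniq s -> {in s, forall x, uniq (g x)} ->
  {in s &, forall x x' t, t \in g x -> t \in g x' -> x = x'} ->
  uniq (flatten (map g s)).
Proof.
elim: s => [//|x s IH] /= /andP[xs us] ug inj.
rewrite cat_uniq ug ?mem_head //= IH //; last 2 first.
- by move=> z zs; apply: ug; rewrite inE zs orbT.
- by move=> z z' zs z's; apply: inj; rewrite inE ?zs ?z's orbT.
rewrite andbT; apply/hasPn => t /flatten_mapP[z zs tz]; apply/negP => tx.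
move: xs; rewrite (inj x z _ _ t tx tz) ?zs ?mem_head //.
by rewrite inE zs orbT.
Qed.

Lemma cat_cons_inj (T : eqType) (b : T) (s s' t t' : seq T) :
  b \notin s -> b \notin s' -> s ++ b :: t = s' ++ b :: t' -> s = s' /\ t = t'.
Proof.
elim: s s' => [|x s IH] [|x' s'] //=; rewrite ?inE ?negb_or.
- by move=> _ _ [->].
- by move=> _ /andP[/eqP bx' _] [].
- by move=> /andP[/eqP bx _] _ [/esym].
move=> /andP[_ bs] /andP[_ bs'] [-> eqs].
by have [-> ->] := IH s' bs bs' eqs.
Qed.

(** The length of the first cycle separates the three families: |A| + 1, more than |A| + 2, and
    exactly |A| + 2. *)
Lemma uniq_forms_step (N : nat) (F : seq 'I_N -> seq (seq (seq 'I_N)))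
    (a b : 'I_N) (A K : seq 'I_N) :
  sorted (@ord_lt N) (b :: K) -> F (b :: K) =i valid_form (b :: K) ->
  uniq (F K) -> uniq (F (b :: K)) -> uniq (forms_step F a b (A, K)).
Proof.
move=> sbK FbK uK ubK.
have headP c : c \in F (b :: K) -> exists r c', c = (b :: r) :: c' /\ r != [::].
  rewrite FbK => /(valid_form_cons sbK)[r [c' [-> r0 _]]].
  by exists r, c'.
have szl c : c \in (if nilp A then [::]
                    else [seq (a :: rev A) :: c | c <- F (b :: K)]) ->
    size (head [::] c) = (size A).+1.
  by case: ifP => // _ /mapP[c1 _ ->] /=; rewrite size_rev.
have szm c : c \in [seq glue (a :: rev A) c | c <- F (b :: K)] ->
    ((size A).+2 < size (head [::] c))%N.
  case/mapP=> c1 /headP[r [c' [-> r0]]] -> /=.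
  by rewrite size_cat size_rev /=; case: r r0 => //= x r _; lia.
have szr c : c \in [seq (a :: rcons (rev A) b) :: c | c <- F K] ->
    size (head [::] c) = (size A).+2.
  by case/mapP=> c1 _ -> /=; rewrite size_rcons size_rev.
rewrite /forms_step !cat_uniq; apply/and5P; split.
- by case: ifP => // _; rewrite map_inj_uniq // => c c' [].
- apply/hasPn => c; rewrite mem_cat => /orP[/szm|/szr] szc; apply/negP => /szl.
    by move=> szE; rewrite szE ltnNge leqnSn in szc.
  by rewrite szc => -[] /eqP; rewrite eqn_leq ltnn.
- rewrite map_inj_in_uniq // => c c' /headP[r [d [-> _]]] /headP[r' [d' [-> _]]].
  by move=> /= [/eqP]; rewrite eqseq_cat // eqxx /= => /eqP[->] ->.
- apply/hasPn => c /szr szc; apply/negP => /szm; rewrite szc.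
  by rewrite ltnn.
- by rewrite map_inj_uniq // => c c' [].
Qed.

Lemma uniq_forms (N m : nat) (L : seq 'I_N) :
  (size L < m)%N -> sorted (@ord_lt N) L -> uniq (forms m L).
Proof.
elim: m L => [//|m IH] [|a [|b L]] szL sL //.
have [sbL bL sLL] : [/\ sorted (@ord_lt N) (b :: L), all (ord_lt b) L
                     & sorted (@ord_lt N) L].
  by move: sL; rewrite !sorted_ord_lt_cons => /and3P[_ -> ->].
have splitsP A K : (A, K) \in splits L ->
    [/\ (size (b :: K) < m)%N, sorted (@ord_lt N) (b :: K),
        sorted (@ord_lt N) K & all (ord_lt b) A].
  move=> /[dup] /size_splits szK; rewrite mem_splits // => /and3P[_ sK pAK].
  move: bL; rewrite -(perm_all _ pAK) all_cat => /andP[bA bK].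
  by split=> //; [rewrite -ltnS; apply: leq_ltn_trans szL | rewrite sorted_ord_lt_cons bK].
apply: uniq_flatten_map.
- exact: uniq_splits.
- move=> [A K] /splitsP[szK sbK sK _].
  apply: uniq_forms_step => //; [exact: mem_forms | | exact: IH].
  by apply: IH => //; apply: ltnW.
(* A common form fixes the split: [rev A] is the stretch between a and b in its word, and K is the
   sorted list of the letters after b. *)
move=> [A K] [A' K'] AK AK' c cAK cAK'.
have [szK sbK sK bA] := splitsP _ _ AK.
have [szK' sbK' sK' bA'] := splitsP _ _ AK'.
have [_ [B cB pB]] := mem_forms_step sL AK (mem_forms (ltnW szK) sK)
  (mem_forms szK sbK) cAK.
have [_ [B' cB' pB']] := mem_forms_step sL AK' (mem_forms (ltnW szK') sK')
  (mem_forms szK' sbK') cAK'.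
have bN D : all (ord_lt b) D -> b \notin rev D.
  by move=> bD; rewrite mem_rev; apply/negP => /(allP bD); rewrite ord_lt_irr.
have [|||/(can_inj revK)-> BE] := @cat_cons_inj _ b (rev A) (rev A') B B'.
- exact: bN.
- exact: bN.
- by move: cB'; rewrite cB => -[].
congr (_, _); apply: (irr_sorted_eq (@ord_lt_trans N) (@ord_lt_irr N)) => // x.
by rewrite -(perm_mem pB) -(perm_mem pB') BE.
Qed.

(** * Permutations and their standard cycle forms *)

Lemma sorted_enum_ord (N : nat) : sorted (@ord_lt N) (enum 'I_N).
Proof.
by have := iota_ltn_sorted 0 N; rewrite -val_enum_ord sorted_map.
Qed.

Lemma sorted_cycle_minima (N : nat) (s : 'S_N) :
  sorted (@ord_lt N) (cycle_minima s).
Proof. exact: (sorted_filter (@ord_lt_trans N)) (sorted_enum_ord N). Qed.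

Lemma cycle_minimaP (N : nat) (s : 'S_N) (x : 'I_N) :
  reflect {in porbit s x, forall z : 'I_N, x <= z}%N (x \in cycle_minima s).
Proof. by rewrite mem_filter mem_enum andbT; apply: (iffP forall_inP). Qed.

Lemma traject_porbit_cons (N : nat) (s : 'S_N) (x : 'I_N) :
  traject s x #|porbit s x| = x :: traject s (s x) #|porbit s x|.-1.
Proof. by have := card_porbit_neq0 s x; case: #|_|. Qed.

Lemma cycle_minima_inj (N : nat) (s : 'S_N) (x x' : 'I_N) :
  x \in cycle_minima s -> x' \in cycle_minima s -> porbit s x = porbit s x' ->
  x = x'.
Proof.
move=> /cycle_minimaP mx /cycle_minimaP mx' eqxx'; apply/val_inj/eqP.
by rewrite eqn_leq mx ?eqxx' ?porbit_id // mx' // -eqxx' porbit_id.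
Qed.

Lemma exists_cycle_minimum (N : nat) (s : 'S_N) (z : 'I_N) :
  exists2 x, x \in cycle_minima s & z \in porbit s x.
Proof.
have [x xz xmin] := arg_minnP (P := [in porbit s z]) val (porbit_id s z).
have eqxz : porbit s x = porbit s z by apply/eqP; rewrite eq_porbit_mem.
exists x; last by rewrite eqxz porbit_id.
by apply/cycle_minimaP => t; rewrite eqxz; apply: xmin.
Qed.

(** Every letter lies in the orbit of exactly one cycle minimum. *)
Lemma standard_cycle_form_perm (N : nat) (s : 'S_N) :
  perm_eq (flatten (standard_cycle_form s)) (enum 'I_N).
Proof.
apply: uniq_perm; rewrite ?enum_uniq //.
  apply: uniq_flatten_map.
  - exact/sorted_ord_lt_uniq/sorted_cycle_minima.
  - by move=> x _; apply: uniq_traject_porbit.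
  move=> x x' mx mx' z; rewrite -!porbit_traject => zx zx'.
  apply: (cycle_minima_inj mx mx').
  by move: zx zx'; rewrite -!eq_porbit_mem => /eqP<- /eqP<-.
move=> z; rewrite mem_enum; apply/flatten_mapP.
have [x mx zx] := exists_cycle_minimum s z.
by exists x; rewrite // -porbit_traject.
Qed.

Lemma heads_min_map (N : nat) (M : seq 'I_N) (g : 'I_N -> seq 'I_N) :
  sorted (@ord_lt N) M ->
  {in M, forall x, exists2 r, g x = x :: r & all (ord_lt x) r} ->
  heads_min (map g M).
Proof.
elim: M => [//|x M IH]; rewrite sorted_ord_lt_cons => /andP[xM sM] gP.
have gP' : {in M, forall x, exists2 r, g x = x :: r & all (ord_lt x) r}.
  by move=> z zM; apply: gP; rewrite inE zM orbT.
have [r gx xr] := gP x (mem_head _ _).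
rewrite /= IH // gx andbT all_cat xr /=.
apply/allP => t /flatten_mapP[z zM]; have [r' -> zr'] := gP' z zM.
have xz := allP xM z zM; rewrite inE => /predU1P[->//|/(allP zr')].
exact: ord_lt_trans.
Qed.

Lemma standard_cycle_form_heads_min (N : nat) (s : 'S_N) :
  heads_min (standard_cycle_form s).
Proof.
apply: heads_min_map (sorted_cycle_minima s) _ => x /cycle_minimaP mx.
exists (traject s (s x) #|porbit s x|.-1); first exact: traject_porbit_cons.
have := uniq_traject_porbit s x; rewrite traject_porbit_cons => /andP[xN _].
apply/allP => z zr; rewrite /ord_lt ltn_neqAle mx.
  by rewrite andbT; apply: contraNneq xN => /val_inj xz; rewrite {1}xz.
by rewrite porbit_traject traject_porbit_cons inE zr orbT.
Qed.

Lemma derangement_standard_cycle_form (N : nat) (s : 'S_N) :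
  derangement s = all (fun r => 1 < size r)%N (standard_cycle_form s).
Proof.
apply/forallP/allP => [ds _ /mapP[x _ ->]|ds x].
  rewrite size_traject ltnNge; apply/negP => /card_le1_eqP sx.
  have /eqP[] := ds x; apply: sx; first exact: porbit_id.
  exact: (mem_porbit s 1).
apply/eqP => sx.
have xP z : z \in porbit s x -> z = x.
  by case/porbitP=> i ->; rewrite permX iter_fix.
have : traject s x #|porbit s x| \in standard_cycle_form s.
  by apply/map_f/cycle_minimaP => z /xP->.
move/ds; rewrite size_traject ltnNge => /negP; apply.
by apply/card_le1_eqP => z t /xP zx /xP tx; rewrite zx tx.
Qed.

Lemma mu_standard_cycle_form (N : nat) (s : 'S_N) :
  mu s = size (standard_cycle_form s).
Proof.
rewrite size_map /mu; set M := cycle_minima s.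
have -> : porbits s = porbit s @: [set x in M].
  apply/setP => B; apply/imsetP/imsetP => -[z zM ->]; last by exists z.
  have [x mx zx] := exists_cycle_minimum s z; exists x; first by rewrite inE.
  by apply/eqP; rewrite eq_porbit_mem.
rewrite card_in_imset => [|x x']; last by rewrite !inE; apply: cycle_minima_inj.
rewrite cardsE; apply/card_uniqP/sorted_ord_lt_uniq.
exact: sorted_cycle_minima.
Qed.

Definition cycle_of (T : eqType) (c : seq (seq T)) (x : T) : seq T :=
  nth [::] c (find (fun r => x \in r) c).

Lemma mem_cycle_of (T : eqType) (c : seq (seq T)) (x : T) :
  x \in flatten c -> cycle_of c x \in c /\ x \in cycle_of c x.
Proof.
move=> /flattenP xc.
have hx : has (fun r => x \in r) c by apply/hasP; case: xc => r; exists r.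
by rewrite /cycle_of; split; [rewrite mem_nth // -has_find | exact: (nth_find [::] hx)].
Qed.

Lemma cycle_of_mem (T : eqType) (c : seq (seq T)) (r : seq T) (x : T) :
  uniq (flatten c) -> r \in c -> x \in r -> cycle_of c x = r.
Proof.
elim: c => [//|r' c IH] /=; rewrite cat_uniq => /and3P[_ r'c uc].
rewrite inE /cycle_of /= => /predU1P[->->//|rc] xr.
case: ifP => [xr'|_]; last exact: IH.
case/hasP: r'c; exists x => //.
by apply/flattenP; exists r.
Qed.

Lemma standard_cycle_form_fcycle (N : nat) (s : 'S_N) r :
  r \in standard_cycle_form s -> fcycle s r.
Proof.
case/mapP=> x _ ->; rewrite traject_porbit_cons /=.
have -> : rcons (traject s (s x) #|porbit s x|.-1) x =
          traject s (s x) #|porbit s x|.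
  have := iter_porbit s x; have := card_porbit_neq0 s x.
  by case: #|_| => // k _; rewrite iterSr => itx; rewrite trajectSr itx.
exact: fpath_traject.
Qed.

(** The form determines s, since s x is the cyclic successor of x in the cycle that contains x. *)
Lemma standard_cycle_form_inj (N : nat) :
  injective (@standard_cycle_form N).
Proof.
suff sE (s : 'S_N) x : s x = next (cycle_of (standard_cycle_form s) x) x.
  by move=> s s' eqs; apply/permP => x; rewrite !sE eqs.
have [|cs xc] := @mem_cycle_of _ (standard_cycle_form s) x.
  by rewrite (perm_mem (standard_cycle_form_perm s)) mem_enum.
by apply/eqP; apply: (next_cycle (standard_cycle_form_fcycle cs) xc).
Qed.

Lemma heads_min_head (N : nat) (c : seq (seq 'I_N)) r :
  heads_min c -> r \in c -> exists2 x, exists r', r = x :: r'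
    & {in r, forall z : 'I_N, x <= z}%N.
Proof.
elim: c => [//|r1 c IH] /= /andP[r1c hc]; rewrite inE.
case/predU1P=> [->|/(IH hc)//]; case: r1 r1c => // x r' xr'.
exists x; first by exists r'.
move=> z; rewrite inE => /predU1P[->//|zr']; apply: ltnW; apply: (allP xr').
by rewrite mem_cat zr'.
Qed.

Lemma heads_min_sorted (N : nat) (x0 : 'I_N) c :
  heads_min c -> sorted (@ord_lt N) (map (head x0) c).
Proof.
elim: c => [//|[//|x r] c IH] /= /andP[xc /[dup] hc /IH sc].
rewrite (path_sortedE (@ord_lt_trans N)) sc andbT.
apply/allP => _ /mapP[r' r'c ->]; apply: (allP xc); rewrite mem_cat.
apply/orP; right; apply/flattenP; exists r' => //.
by have [z [r1 ->] _] := heads_min_head hc r'c; apply: mem_head.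
Qed.

(** The preimage sends each letter to its cyclic successor in c. Its orbits are the cycles of c, and
    by [heads_min] their minima are the heads, in increasing order. *)
Lemma standard_cycle_form_onto (N : nat) (c : seq (seq 'I_N)) :
  perm_eq (flatten c) (enum 'I_N) -> heads_min c ->
  exists s, standard_cycle_form s = c.
Proof.
move=> pc hc; have uc : uniq (flatten c) by rewrite (perm_uniq pc) enum_uniq.
have cyP x : cycle_of c x \in c /\ x \in cycle_of c x.
  by apply: mem_cycle_of; rewrite (perm_mem pc) mem_enum.
have ur r : r \in c -> uniq r.
  elim: c uc {pc hc cyP} => [//|r1 c IH] /=; rewrite cat_uniq inE.
  by case/and3P=> ur1 _ uc /predU1P[->//|/(IH uc)].
(* The cyclic predecessor is a left inverse, so the successor map is injective and defines a
   permutation. *)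
have fK : cancel (fun x => next (cycle_of c x) x) (fun x => prev (cycle_of c x) x).
  move=> x; have [cx xc] := cyP x.
  rewrite (cycle_of_mem uc cx) ?mem_next //.
  exact/prev_next/ur.
pose s := perm (can_inj fK).
have sE r x : r \in c -> x \in r -> s x = next r x.
  by move=> rc xr; rewrite permE (cycle_of_mem uc rc).
have orbP x r' (r := x :: r') : r \in c ->
    porbit s x =i r /\ traject s x #|porbit s x| = r.
  move=> rc; have cyr : fcycle s r.
    rewrite (eq_in_cycle (P := mem r) (e' := frel (next r))) ?all_predT //.
    - exact/cycle_next/ur.
    - by move=> z t zr _; rewrite /= (sE r) //; exact: zr.
    - exact/allP.
  have [k rE] := fpathP cyr.
  have kE : k = size r by move/(congr1 size): rE; rewrite size_rcons size_traject.
  have trE : traject s x (size r) = r.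
    have: traject s x k.+1 = rcons r x by rewrite /= -rE.
    by rewrite trajectSr kE => /rcons_inj/(congr1 fst).
  have oE : porbit s x =i r.
    move=> z; apply/idP/idP => [/porbitP[i ->]|].
      rewrite permX; elim: i => [|i IH] /=; first exact: mem_head.
      by rewrite (sE r) // mem_next.
    by rewrite -trE => /trajectP[i _ ->]; rewrite -permX mem_porbit.
  by split=> //; rewrite (eq_card oE) (card_uniqP (ur r rc)).
(* A letter [x1] is needed as default for [head]; when N = 0 there is none and both forms are
   empty. *)
exists s; have [x1 _|N0] := pickP [pred x : 'I_N | true]; last first.
  rewrite /standard_cycle_form; case: (cycle_minima s) => [|x l]; last by have := N0 x.
  by case: (c) hc => [|[|x r] c'] //; have := N0 x.
have minE : cycle_minima s = map (head x1) c.
  apply: (irr_sorted_eq (@ord_lt_trans _) (@ord_lt_irr _)).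
  - exact: sorted_cycle_minima.
  - exact: heads_min_sorted.
  move=> x; apply/cycle_minimaP/mapP => [mx|[r rc ->]].
    have [cx xc] := cyP x; have [x0 [r' rE] x0min] := heads_min_head hc cx.
    exists (cycle_of c x); rewrite // rE /=; apply/val_inj/eqP.
    have [oE _] := orbP x0 r' (eq_rect _ (fun r => r \in c) cx _ rE).
    rewrite eqn_leq x0min // andbT mx //.
    by rewrite porbit_sym oE -rE.
  have [x0 [r' rE] x0min] := heads_min_head hc rc; subst r.
  by move=> z /=; have [-> _] := orbP x0 r' rc; apply: x0min.
rewrite /standard_cycle_form minE -map_comp map_id_in // => r rc /=.
have [x0 [r' rE] _] := heads_min_head hc rc; subst r.
by have [_ ->] := orbP x0 r' rc.
Qed.

Lemma e_forms (n : nat) :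
  e n = \sum_(c <- forms n.+1 (enum 'I_n)) 'X ^+ size c.
Proof.
have pf : perm_eq [seq standard_cycle_form s | s <- enum (D23_1 n)]
                  (forms n.+1 (enum 'I_n)).
  apply: uniq_perm.
  - by rewrite (map_inj_uniq (@standard_cycle_form_inj n)) enum_uniq.
  - by apply: uniq_forms; rewrite ?size_enum_ord ?sorted_enum_ord.
  move=> c; rewrite mem_forms ?size_enum_ord ?sorted_enum_ord //.
  apply/mapP/idP => [[s]|/and4P[pc szc hc avc]].
    rewrite mem_enum inE derangement_standard_cycle_form => /andP[ds av] ->.
    by apply/and4P; split; rewrite ?standard_cycle_form_perm ?standard_cycle_form_heads_min.
  have [s sE] := standard_cycle_form_onto pc hc; exists s => //.
  by rewrite mem_enum inE derangement_standard_cycle_form /flat sE szc.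
rewrite -(perm_big _ pf) /= big_map /e big_enum_cond /=.
by apply: eq_big => [s|s _]; rewrite ?andbT // mu_standard_cycle_form.
Qed.

(** * Products of the continued fractions *)

(* The values at 0 and 1 extend the recurrence for the products of the gamma's
   below its range. *)
Definition gamma_prod (k : nat) : ratfun :=
  match k with
  | 0 => 1
  | 1 => 0
  | _ => y * \prod_(3 <= j < k.+1) gamma j
  end.

Lemma gamma_prodS (m : nat) :
  gamma_prod m.+3 = gamma_prod m.+2 * gamma m.+3.
Proof. by rewrite /gamma_prod big_nat_recr // mulrA. Qed.

Lemma gammaSS (m : nat) :
  gamma m.+4 = - m.+2%:R + (m.+2%:R + m.+3%:R * y) / gamma m.+3.
Proof.
rewrite gammaE // -[m.+4.-1]/m.+3; congr (_ + (_ + _ * _) / _).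
- by rewrite -[m.+4]/(2 + m.+2)%N natrD opprD addrA subrr add0r.
- by rewrite -[m.+4]/(2 + m.+2)%N natrD addrC addKr.
- by rewrite -[m.+4]/(1 + m.+3)%N natrD addrC addKr.
Qed.

(** For m >= 2, multiply the recurrence of [gamma m.+2] by [gamma_prod m.+1], which is
    [gamma_prod m * gamma m.+1]; the nonzero [gamma m.+1] cancels. The cases m = 0, 1 are direct
    computations. *)
Lemma gamma_prod_rec (m : nat) :
  gamma_prod m.+2 =
    - (m%:R * gamma_prod m.+1) + (m%:R + m.+1%:R * y) * gamma_prod m.
Proof.
case: m => [|[|m]].
- by rewrite /= big_geq // !mulr1 mulr0 oppr0 !add0r mul1r.
- by rewrite /= big_nat1 gamma3 big_geq // !mulr1 mul1r mulr0 addr0 mulrN mulr1.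
have aux (K : fieldType) (g p t a : K) :
    g != 0 -> p * g * (- a + t / g) = - (a * (p * g)) + t * p.
  by move=> g0; field.
by rewrite !gamma_prodS gammaSS; apply: aux; apply: gamma_neq0.
Qed.

Lemma poly_ratfun_e (n : nat) :
  poly_ratfun (e n) = stirling_transform gamma_prod n.
Proof.
rewrite e_forms /poly_ratfun rmorph_sum /=.
under eq_bigr => c _ do rewrite rmorphXn.
have := @sum_forms _ y gamma_prod _ erefl erefl gamma_prod_rec n.+1 (enum 'I_n).
by rewrite size_enum_ord; apply.
Qed.

(** The bound M is free above n because S(n,k) = 0 for k > n; this is the eventual constancy that
    [fps_has_sum] asks for. *)
Lemma poly_ratfun_eE (n M : nat) : (2 <= n)%N -> (n < M)%N ->
  poly_ratfun (e n) =
    y * \sum_(2 <= k < M) (stirling2 n k)%:R * \prod_(3 <= j < k.+1) gamma j.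
Proof.
move=> n2 nM; rewrite poly_ratfun_e stirling_transformE.
rewrite -(big_mkord xpredT (fun k => (stir n k)%:R * gamma_prod k)).
transitivity (\sum_(0 <= k < M) (stir n k)%:R * gamma_prod k).
  rewrite [RHS](big_cat_nat (n := n.+1)) //= [X in _ = _ + X]big_nat.
  by rewrite [X in _ = _ + X]big1 ?addr0 // => k /andP[nk _]; rewrite stir_gt ?mul0r.
have M2 : (2 <= M)%N by apply: leq_trans nM; apply: leqW.
(* The terms k = 0 and k = 1 vanish, by S(n,0) = 0 and [gamma_prod 1 = 0] respectively. *)
rewrite big_ltn ?(ltnW M2) // big_ltn // mulr0 add0r.
have -> : stir n 0 = 0%N by case: n n2 {nM}.
rewrite mul0r add0r mulr_sumr; apply: eq_big_nat => -[|[|k]] // _.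
by rewrite stirling2E mulrCA.
Qed.

Lemma expm1_pow_term (k n : nat) :
  fps_scale (y / k`!%:R * \prod_(3 <= j < k.+1) gamma j) (fps_pow expm1 k) n =
    y * ((stirling2 n k)%:R * \prod_(3 <= j < k.+1) gamma j) / n`!%:R.
Proof.
rewrite /fps_scale (@expm1_pow_coef ratfun k n pchar_ratfun) stirling2E.
have aux (K : fieldType) (f p t d v : K) :
    f != 0 -> v / f * p * (f * t / d) = v * (t * p) / d.
  by move=> f0; rewrite !mulrA; congr (_ / d); field.
apply: aux; rewrite (pcharf0P ratfun).1 -?lt0n ?fact_gt0 //.
exact: pchar_ratfun.
Qed.

Theorem theorem2p13 :
  fps_has_sum 2
    (fun k => fps_scale (y / k`!%:R * \prod_(3 <= j < k.+1) gamma j)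
                        (fps_pow expm1 k))
    E
  /\
  (forall n : nat, (2 <= n)%N ->
     poly_ratfun (e n) =
       y * \sum_(2 <= k < n.+1)
             (stirling2 n k)%:R * \prod_(3 <= j < k.+1) gamma j).
Proof.
split=> [n|n n2]; last exact: poly_ratfun_eE.
exists n.+1 => M nM; rewrite (eq_bigr _ (fun k _ => expm1_pow_term k n)).
rewrite -mulr_suml -mulr_sumr /E; case: (leqP 2 n) => n2.
  by rewrite -poly_ratfun_eE.
(* For n < 2 every S(n,k) with k >= 2 is zero, in agreement with the zero coefficients of [E]. *)
rewrite big_nat big1 ?mulr0 ?mul0r // => k /andP[k2 _].
by rewrite stirling2E stir_gt ?mul0r // (leq_trans n2).
Qed.
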